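(* Let $k \geq 1$ be an integer and let $f = \sum_{n\geq 0} a_f(n)q^n$ be a quasimodular form for $\mathrm{SL}_2(\mathbb{Z})$ of weight $2k$, i.e. $f \in \widetilde{M}_{2k}$. If $a_f(n) = 0$ for all $0 \leq n \leq \left\lceil \frac{k^4 \log(k)}{2} \right\rceil$ (i.e. $\mathrm{ord}_\infty(f) > \left\lceil \frac{k^4 \log(k)}{2} \right\rceil$), then $f = 0$. Equivalently, $f$ is determined uniquely by its first $\left\lceil \frac{k^4 \log(k)}{2} \right\rceil + 1$ Fourier coefficients.
   Context: Let $q = e^{2\pi i z}$. The Eisenstein series are $E_2 = 1 - 24\sum_{n\geq1}\sigma_1(n)q^n$, $E_4 = 1 + 240\sum_{n \geq 1}\sigma_3(n)q^n$, $E_6 = 1 - 504\sum_{n\geq1}\sigma_5(n)q^n$, where $\sigma_\ell(n) = \sum_{d \mid n} d^\ell$. The space $\widetilde{M}_{2k}$ of quasimodular forms of weight $2k$ for $\mathrm{SL}_2(\mathbb{Z})$ is the $\mathbb{C}$-span of the products $E_2^a E_4^b E_6^c$ with $a,b,c \geq 0$ integers and $2a+4b+6c = 2k$, viewed as $q$-series. For $f = \sum a_f(n)q^n$, $\mathrm{ord}_\infty(f) = \min\{n : a_f(n)\neq 0\}$. *)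

(* Defs.v *)
From mathcomp Require Import all_boot all_order all_algebra.
From mathcomp Require Import all_classical all_reals all_analysis.
From mathcomp Require Import complex.
Set Implicit Arguments. Unset Strict Implicit. Unset Printing Implicit Defensive.
Import Order.TTheory GRing.Theory Num.Theory.
Local Open Scope ring_scope.

Definition sigma (l n : nat) : nat := (\sum_(d <- divisors n) d ^ l)%N.

(* formal q-series with coefficients in K, as coefficient sequences *)
Section QSeries.
Variable K : comNzRingType.

Definition qone : nat -> K := fun n => (n == 0%N)%:R.
Definition qmul (f g : nat -> K) : nat -> K :=
  fun n => \sum_(i < n.+1) f i * g (n - i)%N.
Definition qpow (f : nat -> K) (m : nat) : nat -> K := iter m (qmul f) qone.

Definition E2 : nat -> K := fun n => if n == 0%N then 1 else - 24 * (sigma 1 n)%:R.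
Definition E4 : nat -> K := fun n => if n == 0%N then 1 else 240 * (sigma 3 n)%:R.
Definition E6 : nat -> K := fun n => if n == 0%N then 1 else - 504 * (sigma 5 n)%:R.

Definition E246 (a b c : nat) : nat -> K :=
  qmul (qpow E2 a) (qmul (qpow E4 b) (qpow E6 c)).

(* f lies in the K-span of the E2^a E4^b E6^c with 2a+4b+6c = 2k
   (necessarily a, b, c <= k) *)
Definition quasimodular (k : nat) (f : nat -> K) : Prop :=
  exists coef : nat -> nat -> nat -> K,
    f = fun n => \sum_(a < k.+1) \sum_(b < k.+1) \sum_(c < k.+1)
          (if (2 * a + 4 * b + 6 * c == 2 * k)%N
           then coef a b c * E246 a b c n else 0).
End QSeries.

(* ceil (k^4 log k / 2), as a natural number (nonnegative for k >= 1) *)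
Definition sturm_bound (R : realType) (k : nat) : nat :=
  `| Num.ceil ((k%:R : R) ^+ 4 * ln (k%:R : R) / 2) |%N.

(* Main.v *)
From HB Require Import structures.
Require Import Defs.
From mathcomp Require Import all_boot all_order all_algebra.
From mathcomp Require Import all_classical all_reals all_analysis.
From mathcomp Require Import perm complex.
From mathcomp Require Import ring lra zify.
Set Implicit Arguments. Unset Strict Implicit. Unset Printing Implicit Defensive.
Import Order.TTheory GRing.Theory Num.Theory.
Local Open Scope ring_scope.

(** Write a quasimodular form of weight 2k as f = P(E2), where P is a polynomial
    of degree at most k whose coefficients P_i are modular forms of weight
    2k - 2i.  By Ramanujan's identities (obtained here from convolution sums of
    divisor functions) the derivation theta = q d/dq, corrected by a multiple of
    E2, acts on such polynomials.  The determinant d of the (k+1) x (k+1) matrix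
    of coefficients of P and its first k derivatives is a modular form of weight
    2k(k+1), so d = 0 as soon as d vanishes to order greater than k(k+1)/6; and
    by Cramer's rule d vanishes at least to the order of f.  On the other hand,
    if d = 0 then f satisfies a linear differential equation of order at most k
    which is also satisfied by its modular transform, a polynomial of degree k
    in log q with leading coefficient f.  This is impossible if f <> 0, because
    the derivative of a Laurent series is never a nonzero constant.  Finally
    k(k+1)/6 is at most k^4 log(k)/2 up to rounding. *)

(** * Formal power series *)

(* A record, because plain functions already carry a pointwise ring structure. *)
Record fps (K : Type) := Fps { fcoef :> nat -> K }.

HB.instance Definition _ (K : Type) := gen_eqMixin (fps K).
HB.instance Definition _ (K : Type) := gen_choiceMixin (fps K).

Lemma fps_ext (K : Type) (f g : fps K) : (forall n, f n = g n) -> f = g.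
Proof. by case: f g => [f] [g] /= H; congr Fps; apply: funext. Qed.

Section FpsRing.
Variable K : comNzRingType.
Implicit Types f g h : fps K.

Definition fps_zero : fps K := Fps (fun=> 0).
Definition fps_opp f : fps K := Fps (fun n => - f n).
Definition fps_add f g : fps K := Fps (fun n => f n + g n).
Definition fps_one : fps K := Fps (qone K).
Definition fps_mul f g : fps K := Fps (qmul f g).

Lemma fps_addA : associative fps_add.
Proof. by move=> f g h; apply: fps_ext => n /=; rewrite addrA. Qed.
Lemma fps_addC : commutative fps_add.
Proof. by move=> f g; apply: fps_ext => n /=; rewrite addrC. Qed.
Lemma fps_add0 : left_id fps_zero fps_add.
Proof. by move=> f; apply: fps_ext => n /=; rewrite add0r. Qed.
Lemma fps_addN : left_inverse fps_zero fps_opp fps_add.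
Proof. by move=> f; apply: fps_ext => n /=; rewrite addNr. Qed.

HB.instance Definition _ := GRing.isZmodule.Build (fps K)
  fps_addA fps_addC fps_add0 fps_addN.

(* The ring axioms are inherited from polynomials by truncation. *)
Definition trunc n f : {poly K} := \poly_(i < n.+1) f i.

Lemma coef_trunc n f i : (i <= n)%N -> (trunc n f)`_i = f i.
Proof. by move=> lein; rewrite coef_poly ltnS lein. Qed.

Lemma qmul_trunc n f g i : (i <= n)%N -> qmul f g i = (trunc n f * trunc n g)`_i.
Proof.
move=> lein; rewrite coefM; apply: eq_bigr => j _.
have := ltn_ord j; rewrite ltnS => leji.
by rewrite !coef_trunc // (leq_trans _ lein) // leq_subr.
Qed.

Lemma fps_mulC : commutative fps_mul.
Proof. by move=> f g; apply: fps_ext => n /=; rewrite !(@qmul_trunc n) // mulrC. Qed.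

Lemma fps_mulA : associative fps_mul.
Proof.
move=> f g h; apply: fps_ext => n /=.
rewrite (@qmul_trunc n f (fps_mul g h)) // (@qmul_trunc n (fps_mul f g) h) //.
transitivity ((trunc n f * (trunc n g * trunc n h))`_n).
  rewrite !coefM; apply: eq_bigr => j _; congr (_ * _).
  by rewrite coef_trunc ?leq_subr // /= (@qmul_trunc n) // leq_subr.
rewrite mulrA !coefM; apply: eq_bigr => j _; congr (_ * _).
have := ltn_ord j; rewrite ltnS => lejn.
by rewrite coef_trunc // /= (@qmul_trunc n).
Qed.

Lemma fps_mul1 : left_id fps_one fps_mul.
Proof.
move=> f; apply: fps_ext => n /=.
rewrite /qmul big_ord_recl /= /qone eqxx mul1r subn0 big1 ?addr0 // => i _.
by rewrite /= mul0r.
Qed.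

Lemma fps_mulDl : left_distributive fps_mul fps_add.
Proof.
move=> f g h; apply: fps_ext => n /=; rewrite /qmul -big_split /=.
by apply: eq_bigr => i _; rewrite mulrDl.
Qed.

Lemma fps_one_neq0 : fps_one != 0.
Proof.
by apply/eqP => /(congr1 (fun f : fps K => f 0%N)) /eqP; rewrite /= oner_eq0.
Qed.

HB.instance Definition _ := GRing.Zmodule_isComNzRing.Build (fps K)
  fps_mulA fps_mulC fps_mul1 fps_mulDl fps_one_neq0.

Lemma fcoefD f g n : (f + g) n = f n + g n. Proof. by []. Qed.
Lemma fcoefB f g n : (f - g) n = f n - g n. Proof. by []. Qed.
Lemma fcoef0 n : (0 : fps K) n = 0. Proof. by []. Qed.
Lemma fcoef1 n : (1 : fps K) n = (n == 0%N)%:R. Proof. by []. Qed.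
Lemma fcoefM f g n : (f * g) n = \sum_(i < n.+1) f i * g (n - i)%N.
Proof. by []. Qed.
Lemma fcoefMn f m n : (f *+ m) n = f n *+ m.
Proof. by elim: m => [|m IH]; rewrite ?mulr0n // !mulrS fcoefD IH. Qed.
Lemma fcoef_nat m n : (m%:R : fps K) n = if n == 0%N then m%:R else 0.
Proof. by rewrite fcoefMn fcoef1; case: eqP => //=; rewrite mul0rn. Qed.
Lemma fcoef_natM m f n : (m%:R * f) n = m%:R * f n.
Proof. by rewrite !mulr_natl fcoefMn. Qed.
Lemma fcoef_sum (I : Type) (r : seq I) (P : pred I) (F : I -> fps K) n :
  (\sum_(i <- r | P i) F i) n = \sum_(i <- r | P i) F i n.
Proof. exact: (big_morph (fun f : fps K => f n) (fun f g => fcoefD f g n) (fcoef0 n)). Qed.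
Lemma fcoefM_eq0 f g n : (forall i, (i <= n)%N -> g i = 0) ->
  forall i, (i <= n)%N -> (f * g) i = 0.
Proof.
move=> g0 i lein; rewrite fcoefM big1 // => j _.
by rewrite g0 ?mulr0 // (leq_trans (leq_subr _ _)).
Qed.

Definition fcst (c : K) : fps K := Fps (fun n => if n == 0%N then c else 0).

Lemma fcoef_cstM c f n : (fcst c * f) n = c * f n.
Proof.
rewrite fcoefM big_ord_recl subn0 big1 ?addr0 // => i _.
by rewrite /= mul0r.
Qed.
Lemma fcst0 : fcst 0 = 0.
Proof. by apply: fps_ext => -[|n]. Qed.
Lemma fcstM c d : fcst (c * d) = fcst c * fcst d.
Proof. by apply: fps_ext => n; rewrite fcoef_cstM /=; case: eqP; rewrite ?mulr0. Qed.
Lemma fcstD c d : fcst (c + d) = fcst c + fcst d.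
Proof. by apply: fps_ext => n; rewrite fcoefD /=; case: eqP; rewrite ?addr0. Qed.

Definition theta f : fps K := Fps (fun n => n%:R * f n).

Lemma fcoef_theta f n : theta f n = n%:R * f n. Proof. by []. Qed.
Lemma thetaD f g : theta (f + g) = theta f + theta g.
Proof. by apply: fps_ext => n; rewrite fcoefD !fcoef_theta fcoefD mulrDr. Qed.
Lemma theta0 : theta 0 = 0.
Proof. by apply: fps_ext => n; rewrite fcoef_theta fcoef0 mulr0. Qed.
Lemma thetaM f g : theta (f * g) = theta f * g + f * theta g.
Proof.
apply: fps_ext => n; rewrite fcoefD fcoef_theta !fcoefM big_distrr -big_split /=.
apply: eq_bigr => i _; have := ltn_ord i; rewrite ltnS => lein.
by rewrite natrB //; ring.
Qed.
Lemma theta_cst c : theta (fcst c) = 0.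
Proof. by apply: fps_ext => -[|n]; rewrite /= ?mul0r ?mulr0. Qed.
Lemma theta_nat m : theta m%:R = 0.
Proof. by apply: fps_ext => -[|n]; rewrite fcoef_theta fcoef_nat /= ?mul0r ?mulr0. Qed.
Lemma thetaX f m : theta (f ^+ m) = m%:R * f ^+ m.-1 * theta f.
Proof.
elim: m => [|[|m] IH]; first by rewrite expr0 (theta_nat 1) !mul0r.
  by rewrite expr1 expr0 !mul1r.
by rewrite exprS thetaM IH /= exprS; ring.
Qed.
End FpsRing.

(** * Order of vanishing and integrality of the ring of power series *)

Section FpsDomain.
Variable K : idomainType.
Implicit Types f g h : fps K.

Lemma fps_order f : f != 0 ->
  exists n, f n != 0 /\ forall i, (i < n)%N -> f i = 0.
Proof.
move=> fn0; have ex : exists n, f n != 0.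
  apply: contrapT => H; case/eqP: fn0; apply: fps_ext => n.
  by apply: contrapT => /eqP fn; apply: H; exists n.
exists (ex_minn ex); case: ex_minnP => n fn0' nmin; split=> // i ltin.
by apply: contraTeq ltin => /nmin; rewrite -leqNgt.
Qed.

(** Among the index pairs with sum a + b, every pair other than (a, b) has first entry below a or
    second entry below b. *)
Lemma fcoefM_low f g a b :
  (forall i, (i < a)%N -> f i = 0) -> (forall i, (i < b)%N -> g i = 0) ->
  (f * g) (a + b)%N = f a * g b.
Proof.
move=> fa gb; rewrite fcoefM (bigD1 (inord a)) //= inordK ?ltnS ?leq_addr //.
rewrite addKn big1 ?addr0 // => i ina.
have [ltia|] := ltnP i a; first by rewrite fa ?mul0r.
rewrite leq_eqVlt => /orP[/eqP ai|ltai]; last by rewrite gb ?mulr0 //; have := ltn_ord i; lia.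
by case/eqP: ina; apply: ord_inj; rewrite inordK ?ltnS ?leq_addr // ai.
Qed.

(** An integral domain, as required later by [det0P], carries a partial inverse. Classical choice
    supplies it, with f itself as the value where no inverse exists. *)
Definition fps_unit : pred (fps K) := fun f => `[< exists g, g * f = 1 >].
Definition fps_inv f : fps K :=
  if pselect (exists g, g * f = 1) is left ex then projT1 (cid ex) else f.

Lemma fps_mulVr : {in fps_unit, left_inverse 1 fps_inv *%R}.
Proof.
move=> f /asboolP fu; rewrite /fps_inv; case: pselect => // ex.
exact: projT2 (cid ex).
Qed.
Lemma fps_unitPl f g : g * f = 1 -> fps_unit f.
Proof. by move=> gf; apply/asboolP; exists g. Qed.
Lemma fps_inv_out : {in [predC fps_unit], fps_inv =1 id}.
Proof.
move=> f /= fnu; rewrite /fps_inv; case: pselect => // ex.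
by move: fnu; rewrite inE /= => /asboolP; case.
Qed.

HB.instance Definition _ := GRing.ComNzRing_hasMulInverse.Build (fps K)
  fps_mulVr fps_unitPl fps_inv_out.

Lemma fps_domain f g : f * g = 0 -> (f == 0) || (g == 0).
Proof.
move=> fg0; apply: contrapT => /negP; rewrite negb_or => /andP[/fps_order fn0 /fps_order gn0].
case: fn0 gn0 => a [fa flow] [b [gb glow]].
have := fcoefM_low flow glow; rewrite fg0 fcoef0 => /esym/eqP.
by rewrite mulf_eq0 (negbTE fa) (negbTE gb).
Qed.

HB.instance Definition _ := GRing.ComUnitRing_isIntegral.Build (fps K) fps_domain.
End FpsDomain.

(** * Convolution sums of divisor functions *)

Section Quadruples.
Variables (V : nmodType) (n : nat).
Local Notation I := 'I_n.+1.
Implicit Types (u v : I * I * (I * I)) (F : nat -> nat -> nat -> nat -> V).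

(* The quadruples u = ((a, x), (b, y)) of positive integers with ax + by = n. *)
Definition is_repr u :=
  [&& 0 < u.1.1, 0 < u.1.2, 0 < u.2.1, 0 < u.2.2 & u.1.1 * u.1.2 + u.2.1 * u.2.2 == n]%N.

Definition at_quad F u : V := F u.1.1 u.1.2 u.2.1 u.2.2.

Lemma val_inord_if m : (inord m : I) = (if (m <= n)%N then m else 0%N) :> nat.
Proof.
case: leqP => [lemn|ltnm]; first by rewrite inordK.
by rewrite /inord /insubd insubN // -leqNgt.
Qed.

Lemma repr_swap (P : pred (I * I * (I * I))) F :
  \sum_(u | is_repr u && P u) at_quad F u =
  \sum_(u | is_repr u && P (u.2, u.1)) at_quad (fun a x b y => F b y a x) u.
Proof.
rewrite (reindex_onto (fun u => (u.2, u.1)) (fun u => (u.2, u.1))) /=; last by case.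
apply: eq_bigl => -[[a x] [b y]]; rewrite /is_repr /= eqxx andbT; congr (_ && _).
by rewrite addnC; apply/and5P/and5P => -[].
Qed.

Lemma repr_transpose (P : pred (I * I * (I * I))) F :
  \sum_(u | is_repr u && P u) at_quad F u =
  \sum_(u | is_repr u && P ((u.1.2, u.1.1), (u.2.2, u.2.1)))
     at_quad (fun a x b y => F x a y b) u.
Proof.
pose t u := ((u.1.2, u.1.1), (u.2.2, u.2.1)).
rewrite (reindex_onto t t) /=; last by case=> [[? ?] [? ?]].
apply: eq_bigl => -[[a x] [b y]]; rewrite /is_repr /t /= eqxx andbT; congr (_ && _).
by rewrite ![(x * a)%N]mulnC ![(y * b)%N]mulnC; apply/and5P/and5P => -[].
Qed.

(* The bijection behind all identities: ax + by = a(x - y) + (a + b)y. *)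
Lemma repr_shift (g : nat -> nat -> V) :
  \sum_(u | is_repr u && (u.2.2 < u.1.2)%N) g u.1.1 u.2.1 =
  \sum_(u | is_repr u && (u.1.1 < u.2.1)%N) g u.1.1 (u.2.1 - u.1.1)%N.
Proof.
(* The equation ax + by = n with positive entries keeps x + y and a + b at most n on the sums
   concerned, so [inord] does not truncate there. *)
pose h u : I * I * (I * I) := ((u.1.1, inord (u.1.2 + u.2.2)), (inord (u.2.1 - u.1.1), u.2.2)).
pose h' u : I * I * (I * I) := ((u.1.1, inord (u.1.2 - u.2.2)), (inord (u.1.1 + u.2.1), u.2.2)).
rewrite (reindex_onto h h') /=; last first.
  move=> [[a x] [b y]]; rewrite /is_repr /h /h' /= => /andP[/and5P[a0 x0 b0 y0 /eqP E] ltyx].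
  have := ltn_ord a; have := ltn_ord b; have := ltn_ord x; have := ltn_ord y => *.
  have leab : (a + b <= n)%N by nia.
  congr (_, _, (_, _)); apply: ord_inj; rewrite !val_inord_if.
    have -> : (x - y <= n)%N by lia.
    by rewrite subnK ?ifT; lia.
  by rewrite leab addKn ifT //; lia.
apply: eq_big => [[[a x] [b y]]|[[a x] [b y]]]; rewrite /is_repr /h /h' /=; last first.
  move=> _; rewrite val_inord_if ifT //; have := ltn_ord b; lia.
have := ltn_ord a; have := ltn_ord b; have := ltn_ord x; have := ltn_ord y => lty ltx ltb lta.
apply/idP/idP.
  move=> /andP[/andP[/and5P[a0 x0 b0 y0 /eqP E] ltyx] /eqP[/(congr1 val) + /(congr1 val)]] /=.
  move: x0 b0 E ltyx; rewrite !val_inord_if.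
  case: (leqP (x + y) n) => // lexy _; rewrite addnK.
  have -> : (b - a <= n)%N by lia.
  move=> ba0 E ltyx _ _; apply/andP; split; last by lia.
  apply/and5P; split=> //; first [lia | nia | apply/eqP; nia].
move=> /andP[/and5P[a0 x0 b0 y0 /eqP E] ltab].
have lexy : (x + y <= n)%N by nia.
have leba : (b - a <= n)%N by lia.
rewrite !val_inord_if lexy leba; apply/andP; split.
  apply/andP; split; last by lia.
  by apply/and5P; split=> //; first [lia | apply/eqP; nia].
apply/eqP; congr (_, _, (_, _)); apply: ord_inj; rewrite !val_inord_if.
  by rewrite addnK ifT //; lia.
by rewrite subnKC ?ifT //; lia.
Qed.

(** For x = y the equation reads (a + b)x = n: put d = a + b, a divisor of n, so that x = y = n / d
    and b = d - a. *)
Lemma repr_diag F :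
  \sum_(u | is_repr u && (u.1.2 == u.2.2)) at_quad F u =
  \sum_(d < n.+1 | (d %| n)%N) \sum_(a < n.+1 | (0 < a < d)%N)
    F a (n %/ d)%N (d - a)%N (n %/ d)%N.
Proof.
rewrite (partition_big (fun u => inord (u.1.1 + u.2.1) : I) (fun d : I => d %| n)%N) /=; last first.
  move=> [[a x] [b y]] /= /andP[/and5P[/= a0 x0 b0 y0 /eqP E] /eqP/(congr1 val) /= exy].
  rewrite val_inord_if ifT; last by nia.
  by apply/dvdnP; exists x; nia.
apply: eq_bigr => d dvdn; have ltd := ltn_ord d.
pose h (a : I) : I * I * (I * I) := ((a, inord (n %/ d)), (inord (d - a), inord (n %/ d))).
have lend : (n %/ d <= n)%N := leq_div n d.
rewrite (reindex_onto h (fun u => u.1.1)) /=; last first.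
  move=> [[a x] [b y]] /= /andP[/andP[/and5P[/= a0 x0 b0 y0 /eqP E] /eqP/(congr1 val) /= exy] /eqP].
  rewrite /h /= => /(congr1 val); rewrite /= val_inord_if.
  have ltx := ltn_ord x; have ltb := ltn_ord b.
  have -> : (a + b <= n)%N by nia.
  move=> abd; have nd : (n %/ d = x)%N.
    have d0 : (0 < d)%N by lia.
    by apply/eqP; rewrite -(eqn_pmul2r d0) divnK //; apply/eqP; nia.
  congr (_, _, (_, _)); apply: ord_inj; rewrite val_inord_if ?nd.
  - by rewrite -ltnS ltx.
  - by rewrite ifT; lia.
  - by rewrite -exy -ltnS ltx.
apply: eq_big => [a|a]; rewrite /is_repr /h /at_quad /= ?eqxx ?andbT !val_inord_if lend.
  have lta := ltn_ord a; have -> : (d - a <= n)%N by lia.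
  rewrite -mulnDl; apply/idP/idP.
    by move=> /andP[/and5P[-> _ + _ _] _]; rewrite subn_gt0.
  move=> /andP[a0 ltad]; have d0 := ltn_trans a0 ltad.
  have ledn : (d <= n)%N by rewrite -ltnS.
  rewrite (subnKC (ltnW ltad)) mulnC divnK // eqxx a0 subn_gt0 ltad divn_gt0 // ledn /=.
  by apply/eqP; apply: ord_inj; rewrite val_inord_if ledn.
by rewrite ifT // (leq_trans (leq_subr _ _)) // -ltnS.
Qed.

Lemma sum_ord_mul_eq (F : nat -> V) m : (0 < m <= n)%N ->
  \sum_(p : I * I | (p.1 * p.2 == m)%N) F p.1 = \sum_(d < n.+1 | (d %| m)%N) F d.
Proof.
move=> /andP[m0 lemn].
rewrite (partition_big (fun p => p.1) (fun d : I => d %| m)%N) /=; last first.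
  by move=> [a x] /= /eqP <-; rewrite dvdn_mulr.
apply: eq_bigr => d ddm.
rewrite (big_pred1 (d, inord (m %/ d))) // => -[a x] /=.
have lemd := leq_trans (leq_div m d) lemn.
apply/idP/idP => [/andP[/eqP E /eqP ad]|/eqP[-> ->]].
  rewrite -ad -E; apply/eqP; congr (_, _); apply: ord_inj; rewrite val_inord_if mulKn; last by nia.
  by rewrite -ltnS ltn_ord.
by rewrite eqxx andbT val_inord_if lemd mulnC divnK.
Qed.
End Quadruples.

(** * Convolution sums as sums over quadruples *)

Section Convolution.
Variables (K : numFieldType) (n : nat).
Local Notation I := 'I_n.+1.

Lemma sigma_ord l m : (0 < m <= n)%N ->
  (sigma l m)%:R = \sum_(d < n.+1 | (d %| m)%N) d%:R ^+ l :> K.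
Proof.
move=> /andP[m0 lemn]; rewrite /sigma natr_sum.
rewrite (eq_bigr (fun d : nat => d%:R ^+ l)); last by move=> d _; rewrite natrX.
rewrite -(big_mkord (fun d => d %| m)%N (fun d => d%:R ^+ l)) -[RHS]big_filter.
apply: perm_big; apply: uniq_perm; rewrite ?divisors_uniq ?filter_uniq ?iota_uniq // => d.
rewrite -dvdn_divisors // mem_filter mem_index_iota /= andb_idr // => /(dvdn_leq m0) ledm.
by rewrite ltnS (leq_trans ledm).
Qed.

Definition conv i j : K := \sum_(m < n.+1 | (0 < m < n)%N) (sigma i m * sigma j (n - m))%:R.

(** Put m = ax and n - m = by: a divisor a of m and a divisor b of n - m determine x and y. *)
Lemma conv_repr i j :
  conv i j = \sum_(u | is_repr (n := n) u) u.1.1%:R ^+ i * u.2.1%:R ^+ j.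
Proof.
rewrite (partition_big (fun u : I * I * (I * I) => inord (u.1.1 * u.1.2) : I)
                       (fun m : I => 0 < m < n)%N) /=; last first.
  move=> [[a x] [b y]] /and5P[/= a0 x0 b0 y0 /eqP E].
  by rewrite val_inord_if ifT; nia.
apply: eq_bigr => m /andP[m0 ltmn].
rewrite natrM (@sigma_ord i m) ?m0 1?ltnW // (@sigma_ord j (n - m)) ?subn_gt0 ?ltmn ?leq_subr //.
rewrite -(@sum_ord_mul_eq _ n (fun d => d%:R ^+ i)) ?m0 1?ltnW //.
rewrite -(@sum_ord_mul_eq _ n (fun d => d%:R ^+ j)) ?subn_gt0 ?ltmn ?leq_subr //.
rewrite big_distrlr /= pair_big /=.
apply: eq_bigl => -[[a x] [b y]]; rewrite /is_repr /=.
apply/idP/idP => [/andP[/eqP E1 /eqP E2]|/andP[/and5P[a0 x0 b0 y0 /eqP E] /eqP]].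
  apply/andP; split; last by apply/eqP; apply: ord_inj; rewrite val_inord_if E1 ltnW.
  by apply/and5P; split; try nia; apply/eqP; lia.
move=> /(congr1 val); rewrite /= val_inord_if ifT; last by lia.
by move=> <-; rewrite eqxx; apply/eqP; lia.
Qed.
End Convolution.

Lemma sum_trichotomy (V : nmodType) (T : finType) (P : pred T) (s t : T -> nat) (F : T -> V) :
  \sum_(u | P u) F u = \sum_(u | P u && (s u < t u)%N) F u
    + \sum_(u | P u && (t u < s u)%N) F u + \sum_(u | P u && (s u == t u)) F u.
Proof.
rewrite (bigID (fun u => s u < t u)%N) /= -addrA; congr (_ + _).
rewrite (bigID (fun u => t u < s u)%N) /=; congr (_ + _); apply: eq_bigl => u.
  by case: (P u) => //=; lia.
by case: (P u) => //=; lia.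
Qed.

(** * Liouville's method and the values of the convolution sums *)

Section Identities.
Variables (K : numFieldType) (n : nat).
Hypothesis n_gt0 : (0 < n)%N.
Local Notation I := 'I_n.+1.
Implicit Types (g h : nat -> nat -> K).

Lemma sum_inner (F : nat -> K) d : (0 < d <= n)%N ->
  \sum_(a < n.+1 | (0 < a < d)%N) F a = \sum_(a < d) F a - F 0%N.
Proof.
move=> /andP[d0 ledn].
rewrite (big_ord_widen_cond n.+1 xpredT F) 1?ltnW ?ltnS //=.
rewrite [in RHS](bigD1 ord0) //= addrAC subrr add0r.
by apply: eq_bigl => a; rewrite -lt0n andbC.
Qed.

(** Split the sum of g by the order of x and y, and that of h by the order of a and b. The shift
    bijection carries the part x > y onto the part a < b, symmetry matches the opposite parts, and
    only the two diagonals x = y and a = b remain. *)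
Lemma repr_descent g h :
    (forall a b, g a b = g b a) -> (forall a b, h a b = h b a) ->
    (forall a b, (a < b)%N -> g a (b - a)%N = h a b) ->
  \sum_(u | is_repr (n := n) u) (g u.1.1 u.2.1 - h u.1.1 u.2.1) =
  \sum_(d < n.+1 | (d %| n)%N) (\sum_(a < n.+1 | (0 < a < d)%N) g a (d - a)%N
                                 - ((n %/ d)%:R - 1) * h d d).
Proof.
move=> gC hC gh.
have up : \sum_(u | is_repr (n := n) u && (u.2.2 < u.1.2)%N) g u.1.1 u.2.1 =
          \sum_(u | is_repr (n := n) u && (u.1.1 < u.2.1)%N) h u.1.1 u.2.1.
  by rewrite repr_shift; apply: eq_bigr => u /andP[_ /gh].
have down : \sum_(u | is_repr (n := n) u && (u.1.2 < u.2.2)%N) g u.1.1 u.2.1 =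
            \sum_(u | is_repr (n := n) u && (u.2.1 < u.1.1)%N) h u.1.1 u.2.1.
  rewrite (repr_swap (fun u => u.1.2 < u.2.2)%N (fun a _ b _ => g a b)) /at_quad /=.
  rewrite (repr_swap (fun u => u.2.1 < u.1.1)%N (fun a _ b _ => h a b)) /at_quad /=.
  transitivity (\sum_(u | is_repr (n := n) u && (u.2.2 < u.1.2)%N) g u.1.1 u.2.1).
    by apply: eq_bigr => u _; rewrite gC.
  by rewrite up; apply: eq_bigr => u _; rewrite hC.
have diag_h : \sum_(u | is_repr (n := n) u && (u.1.1 == u.2.1)) h u.1.1 u.2.1 =
              \sum_(d < n.+1 | (d %| n)%N) ((n %/ d)%:R - 1) * h d d.
  (* Exchanging (a, b) with (x, y) turns the diagonal a = b into x = y. The summand then depends on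
     n / d alone; after reindexing d by n / d, the inner sum only counts n / d - 1 terms. *)
  rewrite (repr_transpose (fun u : I * I * (I * I) => u.1.1 == u.2.1) (fun a _ b _ => h a b)) /=.
  rewrite (repr_diag n (fun _ x _ y => h x y)).
  have divK d : (d %| n)%N -> (n %/ (n %/ d) = d)%N.
    move=> ddn; have q0 : (0 < n %/ d)%N by rewrite divn_gt0 ?(dvdn_gt0 n_gt0) // dvdn_leq.
    by have := mulKn d q0; rewrite (divnK ddn).
  rewrite (reindex_onto (fun d : I => inord (n %/ d) : I)
                        (fun d : I => inord (n %/ d))) /=; last first.
    by move=> d ddn; apply: ord_inj; rewrite !val_inord_if !leq_div divK.
  apply: eq_big => [d|d].
    have dvd_div e : (e %| n)%N -> (n %/ e %| n)%N.
      by move=> edn; apply/dvdnP; exists e; rewrite mulnC divnK.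
    rewrite val_inord_if !leq_div; apply/andP/idP => [[ddn /eqP <-]|ddn].
      by rewrite val_inord_if !leq_div dvd_div.
    split; first exact: dvd_div.
    by apply/eqP; apply: ord_inj; rewrite val_inord_if !leq_div divK.
  rewrite val_inord_if !leq_div => /andP[ddn /eqP/(congr1 val)].
  rewrite /= val_inord_if leq_div => nd; rewrite nd.
  rewrite (sum_inner (fun=> h d d)) ?leq_div; last by rewrite (dvdn_gt0 n_gt0).
  by rewrite sumr_const card_ord mulrBl mul1r mulr_natl.
have Tg := sum_trichotomy (is_repr (n := n)) (fun u => val u.2.2) (fun u => val u.1.2)
  (fun u => g u.1.1 u.2.1).
have Th := sum_trichotomy (is_repr (n := n)) (fun u => val u.1.1) (fun u => val u.2.1)
  (fun u => h u.1.1 u.2.1).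
rewrite sumrB {}Tg {}Th up down [in RHS]sumrB -diag_h.
have <- := @repr_diag K n (fun a _ b _ => g a b); rewrite /at_quad.
rewrite [X in _ + X - _](eq_bigl (fun u => is_repr u && (u.1.2 == u.2.2))); last first.
  by move=> u; rewrite [in LHS]eq_sym.
by rewrite opprD addrACA subrr add0r.
Qed.

Lemma sum_rev (F : nat -> K) d : \sum_(a < d) F (d - a)%N = \sum_(a < d) F a.+1.
Proof.
rewrite (reindex_inj rev_ord_inj); apply: eq_bigr => a _ /=.
by rewrite subnA // ?subnn ?add0n; congr F; have := ltn_ord a; lia.
Qed.

(** For even j, replacing b by b - a permutes the three powers and turns [gpow] into [hpow]. Their
    difference is (a + b)^j - (a - b)^j, which involves only odd powers of a and b. *)
Definition gpow j a b : K := a%:R ^+ j + b%:R ^+ j + (a + b)%:R ^+ j.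
Definition hpow j a b : K := a%:R ^+ j + b%:R ^+ j + (a%:R - b%:R) ^+ j.

(** Apply [repr_descent] to [gpow] and [hpow] with exponent j = 2m + 2. Since [hpow j d d] is 2 d^j,
    the diagonal gives 2 (n / d) d^j = 2 n d^(j-1), and its remaining 2 d^j cancels the absent term
    a = 0 of the inner sum. *)
Lemma conv_pow m : \sum_(u | is_repr (n := n) u)
    ((u.1.1%:R + u.2.1%:R) ^+ (2 * m.+1) - (u.1.1%:R - u.2.1%:R) ^+ (2 * m.+1)) =
  \sum_(d < n.+1 | (d %| n)%N)
    (\sum_(a < d) (a%:R ^+ (2 * m.+1) + a.+1%:R ^+ (2 * m.+1)) + d%:R ^+ (2 * m.+1).+1)
  - 2 * n%:R * (sigma (2 * m).+1 n)%:R :> K.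
Proof.
have evenpow (x : K) : (- x) ^+ (2 * m.+1) = x ^+ (2 * m.+1) by rewrite !exprM sqrrN.
transitivity (\sum_(u | is_repr (n := n) u)
    (gpow (2 * m.+1) u.1.1 u.2.1 - hpow (2 * m.+1) u.1.1 u.2.1)).
  by apply: eq_bigr => u _; rewrite /gpow /hpow natrD; ring.
rewrite repr_descent; first last.
- move=> a b ltab; rewrite /gpow /hpow subnKC 1?ltnW // natrB 1?ltnW //.
  by rewrite -(opprB b%:R a%:R) evenpow; ring.
- by move=> a b; rewrite /hpow -(opprB b%:R a%:R) evenpow; ring.
- by move=> a b; rewrite /gpow addnC; ring.
rewrite (@sigma_ord _ n) ?n_gt0 ?leqnn // big_distrr -sumrB /=.
apply: eq_bigr => d ddn; have d0 := dvdn_gt0 n_gt0 ddn.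
rewrite (sum_inner (fun a => gpow (2 * m.+1) a (d - a)%N)) ?d0 /= -1?ltnS //.
rewrite [X in _ - X - _]/gpow subn0 add0n.
have -> : \sum_(a < d) gpow (2 * m.+1) a (d - a) =
    \sum_(a < d) (a%:R ^+ (2 * m.+1) + a.+1%:R ^+ (2 * m.+1)) + d%:R ^+ (2 * m.+1).+1.
  rewrite /gpow !big_split /= (sum_rev (fun a => a%:R ^+ (2 * m.+1))); congr (_ + _).
  rewrite (eq_bigr (fun=> d%:R ^+ (2 * m.+1))); last first.
    by move=> a _; rewrite subnKC // ltnW.
  by rewrite sumr_const card_ord exprS mulr_natl.
rewrite /hpow subrr.
have -> : n%:R = (n %/ d)%:R * d%:R :> K by rewrite -natrM divnK.
rewrite [(2 * m.+1)%N]mulnS add2n; move: (\sum_(a < d) _) => S; rewrite !exprS mulr0n; ring.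
Qed.

(** Averaging the sums over 0..d-1 and over 1..d leaves only odd powers of d in Faulhaber's formula,
    so that summation over d | n yields divisor functions of odd index. *)
Lemma power_sum2 d :
  3 * (\sum_(a < d) (a%:R ^+ 2 + a.+1%:R ^+ 2) + d%:R ^+ 3) = 5 * d%:R ^+ 3 + d%:R ^+ 1 :> K.
Proof.
suff H : 3 * \sum_(a < d) (a%:R ^+ 2 + a.+1%:R ^+ 2) =
    2 * d%:R ^+ 3 + d%:R :> K by rewrite mulrDr H; ring.
by elim: d => [|d IH]; rewrite ?big_ord0 ?big_ord_recr /= ?mulrDr ?IH; ring.
Qed.

Lemma power_sum4 d : 15 * (\sum_(a < d) (a%:R ^+ 4 + a.+1%:R ^+ 4) + d%:R ^+ 5) =
  21 * d%:R ^+ 5 + 10 * d%:R ^+ 3 - d%:R ^+ 1 :> K.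
Proof.
suff H : 15 * \sum_(a < d) (a%:R ^+ 4 + a.+1%:R ^+ 4) =
    6 * d%:R ^+ 5 + 10 * d%:R ^+ 3 - d%:R :> K by rewrite mulrDr H; ring.
by elim: d => [|d IH]; rewrite ?big_ord0 ?big_ord_recr /= ?mulrDr ?IH; ring.
Qed.

Lemma power_sum6 d : 21 * (\sum_(a < d) (a%:R ^+ 6 + a.+1%:R ^+ 6) + d%:R ^+ 7) =
  27 * d%:R ^+ 7 + 21 * d%:R ^+ 5 - 7 * d%:R ^+ 3 + d%:R ^+ 1 :> K.
Proof.
suff H : 21 * \sum_(a < d) (a%:R ^+ 6 + a.+1%:R ^+ 6) =
    6 * d%:R ^+ 7 + 21 * d%:R ^+ 5 - 7 * d%:R ^+ 3 + d%:R :> K by rewrite mulrDr H; ring.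
by elim: d => [|d IH]; rewrite ?big_ord0 ?big_ord_recr /= ?mulrDr ?IH; ring.
Qed.

Lemma power_sum_mul22 d :
  30 * \sum_(a < d) a%:R ^+ 2 * (d%:R - a%:R) ^+ 2 = d%:R ^+ 5 - d%:R :> K.
Proof.
(* The upper limit m is separated from x for the induction. The right-hand side is 30 times
   Faulhaber's value of x^2 (sum of a^2) - 2x (sum of a^3) + (sum of a^4). *)
suff H m (x : K) : 30 * \sum_(a < m) a%:R ^+ 2 * (x - a%:R) ^+ 2 =
    5 * x ^+ 2 * (m%:R * (m%:R - 1) * (2 * m%:R - 1))
    - 15 * x * (m%:R * (m%:R - 1)) ^+ 2
    + m%:R * (m%:R - 1) * (2 * m%:R - 1) * (3 * m%:R ^+ 2 - 3 * m%:R - 1).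
  by rewrite H; ring.
by elim: m => [|m IH]; rewrite ?big_ord0 ?big_ord_recr /= ?mulrDr ?IH; ring.
Qed.

Lemma conv_comm i j : conv K n i j = conv K n j i.
Proof.
rewrite !conv_repr (eq_bigl (fun u => is_repr u && true)); last by move=> u; rewrite andbT.
rewrite (repr_swap xpredT (fun a _ b _ => a%:R ^+ i * b%:R ^+ j)) /at_quad.
by apply: eq_big => [u|u _]; rewrite ?andbT 1?mulrC.
Qed.

Lemma sigma_sum l : (sigma l n)%:R = \sum_(d < n.+1 | (d %| n)%N) d%:R ^+ l :> K.
Proof. by rewrite (@sigma_ord _ n) // n_gt0 leqnn. Qed.

Lemma conv11 : 12 * conv K n 1 1 =
  5 * (sigma 3 n)%:R + (1 - 6 * n%:R) * (sigma 1 n)%:R.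
Proof.
have := conv_pow 0; rewrite muln1 muln0.
rewrite (eq_bigr (fun u : I * I * (I * I) => 4 * (u.1.1%:R ^+ 1 * u.2.1%:R ^+ 1)));
  last by move=> u _; ring.
rewrite -mulr_sumr -conv_repr => E.
have -> : 12 * conv K n 1 1 = 3 * (4 * conv K n 1 1) by ring.
rewrite {}E mulrBr mulr_sumr (eq_bigr _ (fun (d : I) _ => power_sum2 d)).
rewrite big_split -mulr_sumr /= -!sigma_sum; ring.
Qed.

Lemma conv13 : 240 * conv K n 1 3 =
  21 * (sigma 5 n)%:R + (10 - 30 * n%:R) * (sigma 3 n)%:R - (sigma 1 n)%:R.
Proof.
have := conv_pow 1; rewrite muln1 -[(2 * 2)%N]/4%N.
rewrite (eq_bigr (fun u : I * I * (I * I) => 8 * (u.1.1%:R ^+ 1 * u.2.1%:R ^+ 3)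
  + 8 * (u.1.1%:R ^+ 3 * u.2.1%:R ^+ 1))); last by move=> u _; ring.
rewrite big_split -!mulr_sumr /= -!conv_repr (conv_comm 3 1) => E.
have -> : 240 * conv K n 1 3 = 15 * (8 * conv K n 1 3 + 8 * conv K n 1 3) by ring.
rewrite {}E mulrBr mulr_sumr (eq_bigr _ (fun (d : I) _ => power_sum4 d)).
rewrite sumrB big_split -!mulr_sumr /= -!sigma_sum; ring.
Qed.

(** The pair (ab(a + b))^2 and (ab(a - b))^2 has difference 4 a^3 b^3, and the second member
    vanishes for a = b, so no term in n appears. The result amounts to E4^2 = E8. *)
Lemma conv33 : 120 * conv K n 3 3 = (sigma 7 n)%:R - (sigma 3 n)%:R.
Proof.
have -> : 120 * conv K n 3 3 = \sum_(u | is_repr (n := n) u)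
    30 * ((u.1.1%:R * u.2.1%:R * (u.1.1 + u.2.1)%:R) ^+ 2
      - (u.1.1%:R * u.2.1%:R * (u.1.1%:R - u.2.1%:R)) ^+ 2).
  by rewrite conv_repr mulr_sumr; apply: eq_bigr => u _; rewrite natrD; ring.
rewrite -mulr_sumr.
rewrite (repr_descent (g := fun a b => (a%:R * b%:R * (a + b)%:R) ^+ 2)
                      (h := fun a b => (a%:R * b%:R * (a%:R - b%:R)) ^+ 2)); first last.
- by move=> a b ltab; rewrite subnKC 1?ltnW // natrB 1?ltnW //; ring.
- by move=> a b; ring.
- by move=> a b; rewrite addnC; ring.
rewrite !sigma_sum -sumrB mulr_sumr; apply: eq_bigr => d ddn.
have d0 := dvdn_gt0 n_gt0 ddn; have ltd := ltn_ord d.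
rewrite (sum_inner (fun a => (a%:R * (d - a)%:R * (a + (d - a))%:R) ^+ 2)) ?d0 //=.
rewrite subrr mulr0 expr0n mulr0 !subr0.
rewrite (eq_bigr (fun a : 'I_d => d%:R ^+ 2 * (a%:R ^+ 2 * (d%:R - a%:R) ^+ 2))); last first.
  by move=> a _; have ltad := ltn_ord a; rewrite subnKC 1?ltnW // natrB 1?ltnW //; ring.
by rewrite [X in _ - X]expr2 !mul0r subr0 -mulr_sumr mulrCA power_sum_mul22; ring.
Qed.

(** The expansion (a + b)^6 - (a - b)^6 = 12 a b^5 + 12 a^5 b + 40 a^3 b^3 also contains [conv33],
    whose value is already known. *)
Lemma conv15 : 504 * conv K n 1 5 =
  20 * (sigma 7 n)%:R + (21 - 42 * n%:R) * (sigma 5 n)%:R + (sigma 1 n)%:R.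
Proof.
have := conv_pow 2; rewrite -[(2 * 2)%N]/4%N -[(2 * 3)%N]/6%N.
rewrite (eq_bigr (fun u : I * I * (I * I) => 12 * (u.1.1%:R ^+ 1 * u.2.1%:R ^+ 5)
  + 12 * (u.1.1%:R ^+ 5 * u.2.1%:R ^+ 1) + 40 * (u.1.1%:R ^+ 3 * u.2.1%:R ^+ 3)));
  last by move=> u _; ring.
rewrite 2!big_split -!mulr_sumr /= -!conv_repr (conv_comm 5 1) => E.
have E3 := conv33.
have -> : 504 * conv K n 1 5 = 21 * (12 * conv K n 1 5 + 12 * conv K n 1 5 + 40 * conv K n 3 3)
    - 7 * (120 * conv K n 3 3) by ring.
rewrite {}E E3 mulrBr mulr_sumr (eq_bigr _ (fun (d : I) _ => power_sum6 d)).
rewrite big_split sumrB big_split -!mulr_sumr /= -!sigma_sum; ring.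
Qed.
End Identities.

(** * Ramanujan's differential equations for E2, E4 and E6 *)

Section Ramanujan.
Variable K : numFieldType.

Definition qE2 : fps K := Fps (E2 K).
Definition qE4 : fps K := Fps (E4 K).
Definition qE6 : fps K := Fps (E6 K).

(** The common shape of E2, E4 and E6, so that one formula covers all their products. *)
Definition eis (c : K) l : fps K := Fps (fun n => if n == 0%N then 1 else c * (sigma l n)%:R).

Lemma fcoef_eisM c d i j n : (0 < n)%N ->
  (eis c i * eis d j) n = c * (sigma i n)%:R + d * (sigma j n)%:R + c * d * conv K n i j.
Proof.
case: n => // n _.
have -> : conv K n.+1 i j = \sum_(m < n) (sigma i m.+1 * sigma j (n - m))%:R.
  rewrite /conv big_mkcond big_ord_recl big_ord_recr /= ltnn add0r addr0.
  by apply: eq_bigr => m _; rewrite /bump /= add1n ltnS ltn_ord subSS.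
rewrite fcoefM big_ord_recl big_ord_recr /= !subn0 subnn mul1r mulr1.
rewrite (eq_bigr (fun m : 'I_n => c * d * (sigma i m.+1 * sigma j (n - m))%:R)).
  by rewrite -mulr_sumr; ring.
move=> m _; have ltm := ltn_ord m.
rewrite /bump /= add1n subSS ifF; last by lia.
by rewrite natrM; ring.
Qed.

Lemma eis_coefS c i n : eis c i n.+1 = c * (sigma i n.+1)%:R. Proof. by []. Qed.
Lemma fcoef0M (f g : fps K) : (f * g) 0%N = f 0%N * g 0%N.
Proof. by rewrite fcoefM big_ord_recl big_ord0 addr0. Qed.

Lemma theta_E2 : 12 * theta qE2 = qE2 ^+ 2 - qE4.
Proof.
apply: fps_ext => -[|n]; rewrite fcoef_natM fcoef_theta fcoefB.
  by rewrite fcoef0M /= mul0r mulr0 mulr1 subrr.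
have H : 12 * conv K n.+1 1 1 = _ := conv11 K (ltn0Sn n).
rewrite -[qE2]/(eis (- 24) 1) -[qE4]/(eis 240 3) fcoef_eisM // !eis_coefS.
have -> : - 24 * - 24 * conv K n.+1 1 1 = 48 * (12 * conv K n.+1 1 1) by ring.
by rewrite H; ring.
Qed.

Lemma theta_E4 : 3 * theta qE4 = qE2 * qE4 - qE6.
Proof.
apply: fps_ext => -[|n]; rewrite fcoef_natM fcoef_theta fcoefB.
  by rewrite fcoef0M /= mul0r mulr0 mulr1 subrr.
have H := conv13 K (ltn0Sn n).
rewrite -[qE2]/(eis (- 24) 1) -[qE4]/(eis 240 3) -[qE6]/(eis (- 504) 5) fcoef_eisM // !eis_coefS.
have -> : - 24 * 240 * conv K n.+1 1 3 = - 24 * (240 * conv K n.+1 1 3) by ring.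
by rewrite H; ring.
Qed.

(** The product E2 E6 is computed by [conv15] and E4^2 by [conv33]; their contributions of sigma_7
    cancel. *)
Lemma theta_E6 : 2 * theta qE6 = qE2 * qE6 - qE4 ^+ 2.
Proof.
apply: fps_ext => -[|n]; rewrite fcoef_natM fcoef_theta fcoefB.
  by rewrite !fcoef0M /= mul0r mulr0 mulr1 subrr.
have H5 := conv15 K (ltn0Sn n); have H3 := conv33 K (ltn0Sn n).
rewrite -[qE2]/(eis (- 24) 1) -[qE4]/(eis 240 3) -[qE6]/(eis (- 504) 5) !fcoef_eisM // !eis_coefS.
have -> : - 24 * - 504 * conv K n.+1 1 5 = 24 * (504 * conv K n.+1 1 5) by ring.
have -> : 240 * 240 * conv K n.+1 3 3 = 480 * (120 * conv K n.+1 3 3) by ring.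
by rewrite H5 H3; ring.
Qed.
End Ramanujan.

(** * Differential operators on power series with a logarithm *)

Section LogPoly.
Variable K : numFieldType.
Local Notation S := (fps K).
Implicit Types (F G H : {poly S}) (c g w : S) (L M : {poly S} -> {poly S}).

(* The indeterminate plays the role of log q: its derivative is 1. *)
Definition dlog F : {poly S} := map_poly (@theta K) F + F^`().

Lemma coef_dlog F i : (dlog F)`_i = theta F`_i + F`_i.+1 *+ i.+1.
Proof. by rewrite coefD coef_deriv coef_map_id0 ?theta0. Qed.

Lemma dlogD F G : dlog (F + G) = dlog F + dlog G.
Proof. by apply/polyP => i; rewrite coefD !coef_dlog !coefD thetaD mulrnDl addrACA. Qed.

Lemma theta_sum (I : Type) (r : seq I) (P : pred I) (f : I -> S) :
  theta (\sum_(i <- r | P i) f i) = \sum_(i <- r | P i) theta (f i).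
Proof. exact: (big_morph (@theta K) (@thetaD K) (theta0 K)). Qed.

Lemma dlogM F G : dlog (F * G) = dlog F * G + F * dlog G.
Proof.
suff mapM : map_poly (@theta K) (F * G) = map_poly (@theta K) F * G + F * map_poly (@theta K) G.
  by rewrite /dlog mapM derivM; ring.
apply/polyP => i; rewrite coefD coef_map_id0 ?theta0 // !coefM theta_sum -big_split.
by apply: eq_bigr => j _; rewrite thetaM !coef_map_id0 ?theta0.
Qed.

Lemma dlogC c : dlog c%:P = (theta c)%:P.
Proof.
by apply/polyP => -[|i]; rewrite coef_dlog !coefC /= mul0rn addr0 // theta0.
Qed.

Lemma dlogX : dlog 'X = 1.
Proof.
apply/polyP => -[|[|i]]; rewrite coef_dlog !coefX coef1 /= ?theta0 ?mul0rn ?addr0 ?add0r //.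
exact: (theta_nat K 1).
Qed.

Lemma dlogZ c F : dlog (c *: F) = theta c *: F + c *: dlog F.
Proof. by rewrite -!mul_polyC dlogM dlogC. Qed.

Lemma dlog_sum (I : Type) (r : seq I) (P : pred I) (f : I -> {poly S}) :
  dlog (\sum_(i <- r | P i) f i) = \sum_(i <- r | P i) dlog (f i).
Proof.
have dlog0 : dlog 0 = 0 by rewrite -polyC0 dlogC theta0.
exact: (big_morph dlog dlogD dlog0).
Qed.

Lemma dlogXn F n : dlog (F ^+ n) = n%:R * F ^+ n.-1 * dlog F.
Proof.
elim: n => [|[|n] IH]; first by rewrite expr0 -polyC1 dlogC (theta_nat _ 1) polyC0 !mul0r.
  by rewrite expr1 expr0 !mul1r.
by rewrite exprS dlogM IH /= exprS; ring.
Qed.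

Lemma size_dlog F : (size (dlog F) <= size F)%N.
Proof.
apply/leq_sizeP => i lei; rewrite coef_dlog !nth_default ?theta0 ?mul0rn ?addr0 //.
exact: leq_trans lei (leqnSn i).
Qed.

(** Linear differential operators whose coefficients are power series free of log q, recognised by
    their action on polynomials in log q. *)
Definition order_lt n L := exists c : nat -> S, forall F, L F = \sum_(j < n) c j *: iter j dlog F.

Lemma order_lt_eq n L M : L =1 M -> order_lt n L -> order_lt n M.
Proof. by move=> LM [c Lc]; exists c => F; rewrite -LM. Qed.

Lemma order_ltW n L : order_lt n L -> order_lt n.+1 L.
Proof.
move=> [c Lc]; exists (fun j => if (j < n)%N then c j else 0) => F.
rewrite Lc big_ord_recr /= ltnn scale0r addr0; apply: eq_bigr => j _.
by rewrite ltn_ord.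
Qed.

Lemma order_ltD n L M : order_lt n L -> order_lt n M -> order_lt n (fun F => L F + M F).
Proof.
move=> [c Lc] [d Md]; exists (fun j => c j + d j) => F.
by rewrite Lc Md -big_split; apply: eq_bigr => j _; rewrite scalerDl.
Qed.

Lemma order_ltZ n c L : order_lt n L -> order_lt n (fun F => c *: L F).
Proof.
move=> [d Ld]; exists (fun j => c * d j) => F.
by rewrite Ld scaler_sumr; apply: eq_bigr => j _; rewrite scalerA.
Qed.

Lemma order_lt_sum n m (M : 'I_m -> {poly S} -> {poly S}) :
  (forall j, order_lt n (M j)) -> order_lt n (fun F => \sum_j M j F).
Proof.
move=> HM; suff H (r : seq 'I_m) : order_lt n (fun F => \sum_(j <- r) M j F) by exact: H.
elim: r => [|j r IH].
  by exists (fun=> 0) => F; rewrite big_nil big1 // => i _; rewrite scale0r.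
apply: (@order_lt_eq _ (fun F => M j F + \sum_(i <- r) M i F)); last exact: order_ltD.
by move=> F; rewrite big_cons.
Qed.

Lemma order_lt_le m n L : (m <= n)%N -> order_lt m L -> order_lt n L.
Proof.
by move=> lemn Lm; rewrite -(subnK lemn); elim: (n - m)%N => // i IH; exact: order_ltW.
Qed.

Lemma order_lt_iter n c : order_lt n.+1 (fun F => c *: iter n dlog F).
Proof.
exists (fun j => if j == n then c else 0) => F.
rewrite big_ord_recr /= eqxx big1 ?add0r // => j _.
by rewrite ltn_eqF ?ltn_ord // scale0r.
Qed.

Lemma order_lt_dlog n L : order_lt n L -> order_lt n.+1 (fun F => dlog (L F)).
Proof.
move=> [c Lc].
apply: (@order_lt_eq _ (fun F => \sum_(j < n) theta (c j) *: iter j dlog F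
    + \sum_(j < n) c j *: iter j.+1 dlog F)).
  by move=> F; rewrite Lc dlog_sum -big_split; apply: eq_bigr => j _; rewrite dlogZ.
apply: order_ltD; first by apply: order_ltW; exists (fun j => theta (c j)).
exists (fun j => if j is i.+1 then c i else 0) => F.
by rewrite big_ord_recl scale0r add0r.
Qed.

Lemma order_lt_size n L F : order_lt n L -> (size (L F) <= size F)%N.
Proof.
move=> [c ->]; apply: (big_ind (fun G => size G <= size F)%N).
- by rewrite size_poly0.
- by move=> G H sG sH; rewrite (leq_trans (size_polyD _ _)) // geq_max sG.
move=> j _; apply: leq_trans (size_scale_leq _ _) _.
elim: (val j) => //= i; exact: leq_trans (size_dlog _).
Qed.

(** This is g^2 times the derivative of F / g. It annihilates g, hence lowers the degree in log q
    when g is the leading coefficient of F. *)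
Definition lower g F := g *: dlog F - theta g *: F.

Lemma iter_lower g n :
  order_lt n.+1 (fun F => iter n dlog (lower g F) - g *: iter n.+1 dlog F).
Proof.
elim: n => [|n IH].
  apply: (@order_lt_eq _ (fun F => - theta g *: iter 0 dlog F)); last exact: order_lt_iter.
  by move=> F /=; rewrite /lower scaleNr addrAC subrr sub0r.
apply: (@order_lt_eq _ (fun F =>
  dlog (iter n dlog (lower g F) - g *: iter n.+1 dlog F) + theta g *: iter n.+1 dlog F)).
  move=> F; have dlogB G H : dlog (G - H) = dlog G - dlog H.
    by apply: (addIr (dlog H)); rewrite addrNK -dlogD addrNK.
  by rewrite dlogB dlogZ -!mul_polyC /=; ring.
by apply: order_ltD; [exact: order_lt_dlog | exact: order_lt_iter].
Qed.

(** Right division of L by the first-order operator [lower g], with remainder c of order zero; the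
    factor s clears denominators. *)
Lemma order_lt_reduce g n L : g != 0 -> order_lt n.+1 L ->
  exists s M c, [/\ s != 0, order_lt n M &
    forall F, s *: L F = M (lower g F) + c *: F].
Proof.
move=> g0; elim: n L => [|n IH] L [c Lc].
  exists 1, (fun=> 0), (c 0%N); split; rewrite ?oner_eq0 //.
    by exists (fun=> 0) => F; rewrite big_ord0.
  by move=> F; rewrite Lc big_ord_recl big_ord0 addr0 add0r scale1r.
(* [N] is g L minus c_(n+1) times the n-th derivative of [lower g], written with the terms of order
   n + 1 already cancelled. *)
pose N F := g *: \sum_(j < n.+1) c j *: iter j dlog F
  + (- c n.+1) *: (iter n dlog (lower g F) - g *: iter n.+1 dlog F).
have [|s [M [d [s0 Mn NE]]]] := IH N.
  apply: order_ltD; apply: order_ltZ; [by exists c | exact: iter_lower].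
exists (s * g), (fun F => M F + (s * c n.+1) *: iter n dlog F), d; split.
- by rewrite mulf_neq0.
- by apply: order_ltD; [exact: order_ltW | exact: order_lt_iter].
move=> F; rewrite addrAC -NE Lc big_ord_recr /= /N /=.
rewrite -!mul_polyC !polyCM !polyCN; ring.
Qed.

(** Otherwise theta(w / g) = -p, while theta of a Laurent series has no constant term. With b the
    order of g: if w vanishes below degree b, the coefficient of degree 2b is p g_b^2; if w has
    order a < b, the coefficient of degree a + b is (a - b) g_b w_a. *)
Lemma wronskian_neq0 g w p : g != 0 -> (0 < p)%N ->
  g * theta w - theta g * w + p%:R * g ^+ 2 != 0.
Proof.
move=> g0 p0; have [b [gb glow]] := fps_order g0.
have thlow (f : S) a : (forall i, (i < a)%N -> f i = 0) ->
    forall i, (i < a)%N -> theta f i = 0.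
  by move=> fl i lti; rewrite fcoef_theta fl ?mulr0.
have [wlow|] := pselect (forall i, (i < b)%N -> w i = 0).
  apply/eqP => /(congr1 (fun f : S => f (b + b)%N)).
  rewrite fcoefD fcoefB fcoef_natM expr2 fcoef0.
  rewrite !(fcoefM_low (a := b) (b := b)) //; try exact: thlow.
  rewrite !fcoef_theta => /eqP; apply/negP.
  have -> : g b * (b%:R * w b) - b%:R * g b * w b + p%:R * (g b * g b) = p%:R * (g b * g b) by ring.
  by rewrite !mulf_neq0 // pnatr_eq0 -lt0n.
move=> nwlow; have w0 : w != 0 by apply: contra_notN nwlow => /eqP -> i _; rewrite fcoef0.
have [a [wa wlow]] := fps_order w0.
have ltab : (a < b)%N.
  by rewrite ltnNge; apply/negP => leba; apply: nwlow => i lti; apply: wlow; apply: leq_trans leba.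
apply/eqP => /(congr1 (fun f : S => f (b + a)%N)).
rewrite fcoefD fcoefB fcoef_natM expr2 fcoef0.
have -> : (g * g) (b + a)%N = 0.
  rewrite fcoefM big1 // => i _.
  have [lti|lei] := ltnP i b; first by rewrite glow ?mul0r.
  by rewrite [X in _ * X]glow ?mulr0 //; lia.
rewrite !(fcoefM_low (a := b) (b := a)) //; try exact: thlow.
rewrite !fcoef_theta mulr0 addr0 => /eqP; apply/negP.
have -> : g b * (a%:R * w a) - b%:R * g b * w a = (a%:R - b%:R) * (g b * w a) by ring.
by rewrite !mulf_neq0 // subr_eq0 eqr_nat ltn_eqF.
Qed.

(** The top coefficient cancels, and the next one is the expression of [wronskian_neq0] for the two
    highest coefficients of F. *)
Lemma size_lower F p : size F = p.+2 -> size (lower (lead_coef F) F) = p.+1.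
Proof.
move=> sF; have gE : F`_p.+1 = lead_coef F by rewrite lead_coefE sF.
have g0 : lead_coef F != 0 by rewrite lead_coef_eq0 -size_poly_eq0 sF.
set g := lead_coef F in gE g0 *.
have coefL i : (lower g F)`_i = g * (theta F`_i + F`_i.+1 *+ i.+1) - theta g * F`_i.
  by rewrite coefB !coefZ coef_dlog.
apply/eqP; rewrite eqn_leq; apply/andP; split.
  apply/leq_sizeP => i; rewrite leq_eqVlt => /orP[/eqP <-|lti]; rewrite coefL.
    by rewrite gE nth_default ?sF // mul0rn addr0; ring.
  by rewrite !nth_default ?sF // ?theta0 ?mul0rn; [ring | exact: leq_trans lti _].
rewrite ltnNge; apply/negP => /leq_sizeP/(_ p (leqnn p)); rewrite coefL gE => /eqP.
apply/negP; have -> : g * (theta F`_p + g *+ p.+1) - theta g * F`_p =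
    g * theta F`_p - theta g * F`_p + p.+1%:R * g ^+ 2 by rewrite -mulr_natl; ring.
exact: wronskian_neq0.
Qed.

(* A solution of degree p in log q yields p + 1 independent solutions, so its order is > p. *)
Lemma log_degree_lt_order r c L F :
    order_lt r (fun G => L G - c *: iter r dlog G) -> c != 0 -> (r < size F)%N ->
  L F != 0.
Proof.
elim: r c L F => [|r IH] c L F Lr c0 ltrF.
  case: Lr => d /(_ F); rewrite big_ord0 => /eqP; rewrite subr_eq0 => /eqP ->.
  by rewrite -mul_polyC mulf_neq0 ?polyC_eq0 //= -size_poly_gt0.
case sF : (size F) ltrF => [//|[//|p]] ltrF.
set g := lead_coef F.
have g0 : g != 0 by rewrite /g lead_coef_eq0 -size_poly_eq0 sF.
(* Reduction of order: [N] is g L minus c times the r-th derivative of [lower g], free of order r +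
   1. Dividing it by [lower g] gives s g L = L1 (lower g) + d, where L1 has order r and leading
   coefficient s c. *)
pose N G := g *: (L G - c *: iter r.+1 dlog G)
  + (- c) *: (iter r dlog (lower g G) - g *: iter r.+1 dlog G).
have [|s [M [d [s0 Mr NE]]]] := @order_lt_reduce g r N g0.
  apply: order_ltD; apply: order_ltZ => //; exact: iter_lower.
pose L1 G := (s * c) *: iter r dlog G + M G.
have E G : (s * g) *: L G = L1 (lower g G) + d *: G.
  rewrite /L1 -addrA -NE /N -!mul_polyC !polyCM !polyCN; ring.
have L1r : order_lt r (fun G => L1 G - (s * c) *: iter r dlog G).
  by apply: order_lt_eq Mr => G; rewrite /L1 addrAC subrr add0r.
have sH := size_lower sF; rewrite -/g in sH.
apply/eqP => LF0; have := E F; rewrite LF0 scaler0 => /esym E0.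
(* In degree p + 1 only d g survives, since [lower g F] has degree p and L1 does not raise
   degrees. *)
have d0 : d = 0.
  have L1lt : order_lt r.+1 L1 by apply: order_ltD; [exact: order_lt_iter | exact: order_ltW].
  have := congr1 (fun G : {poly S} => G`_p.+1) E0.
  rewrite coefD coefZ nth_default ?add0r ?coef0; last first.
    by rewrite -sH; apply: order_lt_size L1lt.
  have -> : F`_p.+1 = g by rewrite /g lead_coefE sF.
  by move=> /eqP; rewrite mulf_eq0 (negbTE g0) orbF => /eqP.
have := IH (s * c) L1 (lower g F) L1r (mulf_neq0 s0 c0).
have L10 : L1 (lower g F) = 0 by move: E0; rewrite d0 scale0r addr0.
by rewrite sH L10 eqxx => /(_ ltrF).
Qed.
End LogPoly.

(** * Modular forms *)

Section Modular.
Variable K : numFieldType.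
Local Notation S := (fps K).
Local Notation e := (qE2 K).
Local Notation y := (qE4 K).
Local Notation z := (qE6 K).
Implicit Types (f g : S) (c : K).

(** The algebraic description of modular forms, as the span of the monomials in E4 and E6 graded by
    weight. *)
Inductive modular : nat -> S -> Prop :=
| modular0 v : modular v 0
| modular_mon c i j : modular (4 * i + 6 * j) (fcst c * y ^+ i * z ^+ j)
| modularD v f g : modular v f -> modular v g -> modular v (f + g).

Lemma modular_mon_eq c i j v f :
  v = (4 * i + 6 * j)%N -> f = fcst c * y ^+ i * z ^+ j -> modular v f.
Proof. by move=> -> ->; exact: modular_mon. Qed.

Lemma modularM v w f g : modular v f -> modular w g -> modular (v + w) (f * g).
Proof.
move=> vf wg; elim: vf => {v f} [v|c i j|v f1 f2 _ IH1 _ IH2].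
- by rewrite mul0r; exact: modular0.
- elim: wg => {w g} [w|d k l|w g1 g2 _ IH1 _ IH2].
  + by rewrite mulr0; exact: modular0.
  + apply: (@modular_mon_eq (c * d) (i + k) (j + l)); first by lia.
    by rewrite fcstM !exprD; ring.
  + by rewrite mulrDr; exact: modularD.
- by rewrite mulrDl; exact: modularD.
Qed.

Lemma modular_cst c : modular 0 (fcst c).
Proof. by apply: (@modular_mon_eq c 0 0) => //; rewrite !expr0 !mulr1. Qed.

Lemma fcst_nat m : fcst m%:R = m%:R :> S.
Proof. by apply: fps_ext => n; rewrite fcoef_nat. Qed.

Lemma modularZ v c f : modular v f -> modular v (fcst c * f).
Proof. exact: (modularM (modular_cst c)). Qed.

Lemma modular_natM v m f : modular v f -> modular v (m%:R * f).
Proof. by rewrite -fcst_nat; exact: modularZ. Qed.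

Lemma modularN v f : modular v f -> modular v (- f).
Proof.
move=> vf; have -> : - f = fcst (-1) * f by apply: fps_ext => n; rewrite fcoef_cstM mulN1r.
exact: modularZ.
Qed.

Lemma modularB v f g : modular v f -> modular v g -> modular v (f - g).
Proof. by move=> vf vg; apply: modularD => //; exact: modularN. Qed.

Lemma modular_sum v (I : Type) (r : seq I) (P : pred I) (F : I -> S) :
  (forall i, P i -> modular v (F i)) -> modular v (\sum_(i <- r | P i) F i).
Proof.
by move=> H; apply: big_ind => //; [exact: modular0 | move=> f g; exact: modularD].
Qed.

Lemma modular_prod (I : Type) (r : seq I) (v : I -> nat) (F : I -> S) :
  (forall i, modular (v i) (F i)) -> modular (\sum_(i <- r) v i) (\prod_(i <- r) F i).
Proof.
move=> H; elim: r => [|i r IH]; last by rewrite !big_cons; exact: modularM.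
rewrite !big_nil; have -> : 1 = fcst 1 :> S by rewrite (fcst_nat 1).
exact: modular_cst.
Qed.

Lemma modular_qE4 : modular 4 y.
Proof. by apply: (@modular_mon_eq 1 1 0) => //; rewrite (fcst_nat 1) expr0 mul1r mulr1. Qed.

(* Twelve times the Serre derivative. *)
Definition serre v f : S := 12 * theta f - v%:R * e * f.

Lemma modular_serre v f : modular v f -> modular v.+2 (serre v f).
Proof.
rewrite /serre; elim=> {v f} [v|c i j|v f g _ IHf _ IHg].
- by rewrite theta0 !mulr0 subr0; exact: modular0.
- have -> : 12 * theta (fcst c * y ^+ i * z ^+ j)
      - (4 * i + 6 * j)%:R * e * (fcst c * y ^+ i * z ^+ j) =
    (- 4%:R) * i%:R * (fcst c * y ^+ i.-1 * z ^+ j.+1)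
    - 6%:R * j%:R * (fcst c * y ^+ i.+2 * z ^+ j.-1).
    rewrite !thetaM theta_cst !thetaX.
    (* The factors 3 and 2 prepare Ramanujan's identities, after which the multiples of E2 cancel.
       The truncated exponents [i.-1] and [j.-1] at zero are harmless: they come with the factors i
       and j. *)
    transitivity (fcst c * (4 * (i%:R * y ^+ i.-1 * z ^+ j * (3 * theta y))
        + 6 * (j%:R * y ^+ i * z ^+ j.-1 * (2 * theta z)))
      - (4 * i + 6 * j)%:R * e * (fcst c * y ^+ i * z ^+ j)); first by ring.
    rewrite theta_E4 theta_E6.
    by case: i => [|i]; case: j => [|j] /=; rewrite ?exprS; ring.
  have mon k l m : (m = 4 * k + 6 * l)%N -> modular m (fcst c * y ^+ k * z ^+ l).
    by move->; exact: modular_mon.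
  apply: modularB; rewrite -mulrA ?mulNr; [apply: modularN|];
    apply: modular_natM.
  + case: i => [|i]; first by rewrite mul0r; exact: modular0.
    by apply: modular_natM; apply: mon => /=; lia.
  + case: j => [|j]; first by rewrite mul0r; exact: modular0.
    by apply: modular_natM; apply: mon => /=; lia.
have -> : 12 * theta (f + g) - v%:R * e * (f + g) =
  (12 * theta f - v%:R * e * f) + (12 * theta g - v%:R * e * g) by rewrite thetaD; ring.
exact: modularD.
Qed.

(** This is 1728 times the discriminant form. *)
Definition delta : S := y ^+ 3 - z ^+ 2.

(* Every weight has a single monomial E4^i E6^j with j <= 1. *)
Lemma modular_mod_delta v f : modular v f -> exists c g,
  [/\ f = fcst c * y ^+ ((v - 6 * odd v./2) %/ 4) * z ^+ odd v./2 + delta * g,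
      modular (v - 12) g & (v < 12)%N -> g = 0].
Proof.
elim=> {v f} [v|c i j|v f1 f2 _ [c1 [g1 [-> g1m g10]]] _ [c2 [g2 [-> g2m g20]]]].
- exists 0, 0; rewrite fcst0 !mul0r mulr0 addr0; split=> //; exact: modular0.
- have [m] := ubnP j; elim: m i j => // m IH i [|[|j]] ltjm.
  + exists c, 0; rewrite mulr0 addr0; split=> //; last exact: modular0.
    have -> : (4 * i + 6 * 0)./2 = (2 * i)%N by lia.
    by rewrite oddM /= muln0 subn0 addn0 mulKn.
  + exists c, 0; rewrite mulr0 addr0; split=> //; last exact: modular0.
    have -> : (4 * i + 6 * 1)./2 = (2 * i + 3)%N by lia.
    by rewrite oddD oddM /= addnK mulKn.
  (* The relation E6^2 = E4^3 - [delta] trades two factors E6 for three factors E4 at equal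
     weight. *)
  + have [|d [g [fE gm g0]]] := IH i.+3 j; first by lia.
    have -> : (4 * i + 6 * j.+2 = 4 * i.+3 + 6 * j)%N by lia.
    exists d, (g - fcst c * y ^+ i * z ^+ j); split.
    * by rewrite mulrBr addrA -fE /delta !exprS; ring.
    * by apply: modularB => //; apply: (@modular_mon_eq c i j) => //; lia.
    * by lia.
exists (c1 + c2), (g1 + g2); split; first by rewrite fcstD; ring.
  exact: modularD.
by move=> ltv; rewrite g10 ?g20 ?addr0.
Qed.

Lemma fcoef0X f n : (f ^+ n) 0%N = f 0%N ^+ n.
Proof. by elim: n => // n IH; rewrite !exprS fcoef0M IH. Qed.

Lemma delta_coef0 : delta 0%N = 0.
Proof. by rewrite fcoefB !fcoef0X /= !expr1n subrr. Qed.

Lemma delta_coef1 : delta 1%N = 1728.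
Proof.
have coef1M f g : (f * g) 1%N = f 0%N * g 1%N + f 1%N * g 0%N.
  by rewrite fcoefM !big_ord_recl big_ord0 addr0.
rewrite /delta !exprS !expr0 !mulr1 fcoefB !coef1M !fcoef0M.
by rewrite /= /E4 /E6 /sigma /= !big_cons !big_nil !exp1n; ring.
Qed.

(** The constant coefficient kills the monomial left modulo [delta], so f = delta g with g of weight
    v - 12. As [delta] has order one, g vanishes to one order less, and induction on the weight
    applies. *)
Lemma modular_vanish v f : modular v f -> (forall n, (n <= v %/ 12)%N -> f n = 0) -> f = 0.
Proof.
have [m] := ubnP v; elim: m v f => // m IH v f ltvm vf f0.
have [c [g [fE gm g0]]] := modular_mod_delta vf.
have c0 : c = 0.
  have := f0 0%N (leq0n _); rewrite fE fcoefD !fcoef0M delta_coef0 mul0r addr0.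
  by rewrite !fcoef0X /= !expr1n !mulr1.
have {c0}fE : f = delta * g by rewrite fE c0 fcst0 !mul0r add0r.
have [ltv|le12v] := ltnP v 12; first by rewrite fE g0 // mulr0.
rewrite fE (IH (v - 12)%N g) ?mulr0 //; first by lia.
elim/ltn_ind => n IHn len.
have := f0 n.+1; rewrite fE -add1n (fcoefM_low (a := 1)); first last.
- by move=> i lti; apply: IHn => //; exact: leq_trans (ltnW lti) len.
- by case=> // _; exact: delta_coef0.
rewrite delta_coef1 => H; have /eqP := H ltac:(lia).
by rewrite mulf_eq0 pnatr_eq0 /= => /eqP.
Qed.
End Modular.

(** * Quasimodular forms *)

Section Quasimodular.
Variables (K : numFieldType) (k : nat).
Local Notation S := (fps K).
Local Notation e := (qE2 K).
Local Notation y := (qE4 K).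
Local Notation z := (qE6 K).
Implicit Types (P : nat -> S) (w : nat).

(* A quasimodular form is represented by its coefficients [P i] in powers of E2. *)
Definition qeval P : S := \sum_(i < k.+1) P i * e ^+ i.

(* [12 (theta - (w - k) / 12 * E2)], computed on the coefficients. *)
Definition qserre w P : nat -> S := fun i =>
  serre (w - 2 * i) (P i) - i.+1%:R * (y * P i.+1)
  + (k.+1 - i)%:R * (if i is j.+1 then P j else 0).

Lemma qserre_supp w P : (forall i, (k < i)%N -> P i = 0) ->
  forall i, (k < i)%N -> qserre w P i = 0.
Proof.
move=> P0 i ltki; rewrite /qserre /serre P0 // P0; last exact: ltn_trans ltki _.
have -> : (k.+1 - i = 0)%N by lia.
by rewrite theta0 !mulr0 mul0r !subr0 addr0.
Qed.

Lemma modular_qserre w P : (2 * k <= w)%N ->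
    (forall i, (k < i)%N -> P i = 0) ->
    (forall i, (i <= k)%N -> modular (w - 2 * i) (P i)) ->
  forall i, (i <= k)%N -> modular (w.+2 - 2 * i) (qserre w P i).
Proof.
move=> lew P0 Pm i lei; rewrite /qserre; apply: modularD; first apply: modularB.
- have -> : (w.+2 - 2 * i = (w - 2 * i).+2)%N by lia.
  by apply: modular_serre; exact: Pm.
- apply: modular_natM; have [ltik|leki] := ltnP i k; last by rewrite P0 // mulr0; exact: modular0.
  have -> : (w.+2 - 2 * i = 4 + (w - 2 * i.+1))%N by lia.
  by apply: modularM; [exact: modular_qE4 | exact: Pm].
apply: modular_natM; case: i lei => [|i] lei; first exact: modular0.
have -> : (w.+2 - 2 * i.+1 = w - 2 * i)%N by lia.
by apply: Pm; exact: ltnW.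
Qed.

(** X times the transform E2 + 12 / X of E2. *)
Definition slash : {poly S} := e%:P * 'X + 12.

(* [X^k P(E2 + 12 / X)]: the transform of the form under z |-> -1/z, with X = log q. *)
Definition logpoly P : {poly S} := \sum_(i < k.+1) (P i)%:P * slash ^+ i * 'X ^+ (k - i).

Lemma dlog_slash : 12 * dlog slash = e%:P * slash - y%:P * 'X.
Proof.
have dlog12 : dlog (12 : {poly S}) = 0.
  by rewrite -(polyC_natr _ 12) dlogC theta_nat.
rewrite /slash dlogD dlogM dlogC dlogX dlog12 addr0 mulr1.
have -> : 12 * ((theta e)%:P * 'X + e%:P) = (12 * theta e)%:P * 'X + 12 * e%:P.
  by rewrite polyCM (polyC_natr _ 12); ring.
by rewrite theta_E2 polyCB polyC_exp; ring.
Qed.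

(** By Leibniz' rule on each summand, [u] lowers the exponent of [slash] by one and [v] raises it by
    one; reindexing them yields the terms in P (i + 1) and P (i - 1) of [qserre]. *)
Lemma dlog_logpoly w P : (2 * k <= w)%N -> (forall i, (k < i)%N -> P i = 0) ->
  12 * dlog (logpoly P) = logpoly (qserre w P) + ((w - k)%:R * e)%:P * logpoly P.
Proof.
move=> lew P0.
pose u i := i%:R * (y * P i)%:P * slash ^+ i.-1 * 'X ^+ (k.+1 - i) : {poly S}.
pose v i := (k - i)%:R * (P i)%:P * slash ^+ i.+1 * 'X ^+ (k - i).-1 : {poly S}.
have shift_u : \sum_(i < k.+1) u i =
    \sum_(i < k.+1) (i.+1%:R * (y * P i.+1))%:P * slash ^+ i * 'X ^+ (k - i).
  rewrite big_ord_recl big_ord_recr /= P0 // {1}/u !(mulr0, mul0r, polyC0) add0r addr0.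
  by apply: eq_bigr => i _; rewrite /u /bump /= add1n subSS !polyCM !polyC_natr.
have shift_v : \sum_(i < k.+1) v i =
    \sum_(i < k.+1) ((k.+1 - i)%:R * (if i : nat is j.+1 then P j else 0))%:P
       * slash ^+ i * 'X ^+ (k - i).
  rewrite big_ord_recr big_ord_recl /= {2}/v subnn !(mulr0, mul0r, polyC0) add0r addr0.
  apply: eq_bigr => i _; rewrite /v /bump /= add1n subSS !polyCM !polyC_natr.
  by have -> : (k - i.+1 = (k - i).-1)%N by lia.
transitivity (\sum_(i < k.+1) ((serre (w - 2 * i) (P i))%:P * slash ^+ i * 'X ^+ (k - i)
    + ((w - k)%:R * e)%:P * ((P i)%:P * slash ^+ i * 'X ^+ (k - i)) - u i + v i)).
  rewrite /logpoly dlog_sum mulr_sumr; apply: eq_bigr => i _.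
  have lei : (i <= k)%N by rewrite -ltnS.
  rewrite !dlogM dlogC !dlogXn dlogX.
  transitivity ((12 * theta (P i))%:P * slash ^+ i * 'X ^+ (k - i)
     + (P i)%:P * (i%:R * slash ^+ i.-1 * 'X ^+ (k - i) * (12 * dlog slash))
     + (P i)%:P * ((k - i)%:R * slash ^+ i * 'X ^+ (k - i).-1 * 12)).
    by rewrite !polyCM !polyC_natr; ring.
  rewrite dlog_slash.
  (* This splits 12 times the derivative of X^(k-i) into the factor of [v i] and a multiple of E2;
     the multiples of E2 then add up to weight w - k. *)
  have -> : 12 = slash - e%:P * 'X :> {poly S} by rewrite /slash; ring.
  rewrite /serre /u /v !polyCB !polyCM !polyC_natr.
  have -> : (k.+1 - i = (k - i).+1)%N by lia.
  have [m mk] : exists m, (k - i)%N = m by eexists.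
  have -> : (w - 2 * i)%:R = (w - k)%:R + (k - i)%:R - i%:R :> {poly S}.
    by rewrite -natrD -natrB; [congr _%:R; lia | lia].
  rewrite {}mk; case: (val i) => [|j]; case: m => [|m] /=; rewrite ?expr0 ?exprS; ring.
rewrite !big_split sumrN /= shift_u shift_v -mulr_sumr /logpoly /qserre.
rewrite [X in X + _ = _]addrAC [X in X = _]addrAC; congr (_ + _).
rewrite -sumrN -!big_split /=; apply: eq_bigr => i _.
by rewrite !polyCD polyCN; ring.
Qed.

Lemma coef_slash i : (slash ^+ i)`_i = e ^+ i /\ (size (slash ^+ i) <= i.+1)%N.
Proof.
have cE F n : (slash * F)`_n = e * ('X * F)`_n + 12 * F`_n.
  by rewrite /slash mulrDl -mulrA coefD -(polyC_natr _ 12) !coefCM.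
elim: i => [|i [IHc /leq_sizeP IHs]]; first by rewrite expr0 coef1 size_poly1.
split; first by rewrite exprS cE coefXM /= IHc IHs // mulr0 addr0 exprS.
apply/leq_sizeP => j ltij; rewrite exprS cE coefXM; case: j ltij => [//|j] ltij /=.
by rewrite !IHs ?mulr0 ?addr0 // ltnW.
Qed.

(** The summand of index i has degree at most i + (k - i) = k, reached with coefficient P_i E2^i. *)
Lemma coef_logpoly P : (logpoly P)`_k = qeval P.
Proof.
rewrite /logpoly coef_sum; apply: eq_bigr => i _.
have lei : (i <= k)%N by rewrite -ltnS.
rewrite -mulrA coefCM coefMXn ltnNge leq_subr /= subKn //.
by case: (coef_slash i) => ->.
Qed.

Lemma size_logpoly P : (size (logpoly P) <= k.+1)%N.
Proof.
apply/leq_sizeP => j ltkj; rewrite /logpoly coef_sum big1 // => i _.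
rewrite -mulrA coefCM coefMXn; case: ifP => _; rewrite ?mulr0 //.
case: (coef_slash i) => _ /leq_sizeP ->; rewrite ?mulr0 //.
have := ltn_ord i; lia.
Qed.

(** Compare the coefficients of X^k in [dlog_logpoly]; the derivative in X contributes nothing
    there, as the degree is at most k. *)
Lemma qeval_qserre w P : (2 * k <= w)%N -> (forall i, (k < i)%N -> P i = 0) ->
  qeval (qserre w P) = 12 * theta (qeval P) - (w - k)%:R * e * qeval P.
Proof.
move=> lew P0; have := congr1 (fun F : {poly S} => F`_k) (dlog_logpoly lew P0).
rewrite coefD -(polyC_natr _ 12) !coefCM coef_dlog !coef_logpoly.
rewrite [_`_k.+1]nth_default ?size_logpoly // mul0rn addr0 => ->; ring.
Qed.

Variable P0 : nat -> S.
Hypothesis P0_supp : forall i, (k < i)%N -> P0 i = 0.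
Hypothesis P0_modular : forall i, (i <= k)%N -> modular (2 * k - 2 * i) (P0 i).

Fixpoint Pseq j : nat -> S := if j is i.+1 then qserre (2 * k + 2 * i) (Pseq i) else P0.

Lemma Pseq_supp j i : (k < i)%N -> Pseq j i = 0.
Proof. by elim: j i => [|j IH] i; [exact: P0_supp | exact: qserre_supp]. Qed.

Lemma Pseq_modular j i : (i <= k)%N -> modular (2 * k + 2 * j - 2 * i) (Pseq j i).
Proof.
elim: j i => [|j IH] i lei; first by rewrite muln0 addn0; exact: P0_modular.
have -> : (2 * k + 2 * j.+1 = (2 * k + 2 * j).+2)%N by lia.
by apply: modular_qserre => //; [lia | exact: Pseq_supp].
Qed.

Lemma Pseq_vanish N : (forall n, (n <= N)%N -> qeval P0 n = 0) ->
  forall j n, (n <= N)%N -> qeval (Pseq j) n = 0.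
Proof.
move=> v0; elim=> [|j IH] //= n len.
rewrite qeval_qserre; [|lia|exact: Pseq_supp].
by rewrite fcoefB fcoef_natM fcoef_theta IH // !mulr0 (fcoefM_eq0 _ IH) // subr0.
Qed.

Definition Pmx : 'M[S]_k.+1 := \matrix_(j, i) Pseq j i.

(** The entry in row j and column i has weight 2k + 2j - 2i. In each term of the Leibniz expansion
    the row and column indices cancel in total. *)
Lemma modular_det : modular (k.+1 * (2 * k)) (\det Pmx).
Proof.
apply: modular_sum => s _.
suff H : modular (k.+1 * (2 * k)) (\prod_i Pmx i (s i)).
  by case: (s : bool); rewrite ?expr0 ?mul1r // expr1 mulN1r; exact: modularN.
have -> : (k.+1 * (2 * k) = \sum_(i < k.+1) (2 * k + 2 * i - 2 * s i))%N.
  apply: (@addIn (\sum_(i < k.+1) 2 * s i)%N); rewrite -big_split.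
  rewrite [in RHS](eq_bigr (fun i : 'I_k.+1 => 2 * k + 2 * i)%N); last first.
    by move=> i _; apply: subnK; have := ltn_ord (s i); lia.
  rewrite [in RHS]big_split big_const_ord iter_addn_0 mulnC; congr (_ + _)%N.
  by rewrite [RHS](reindex_inj (@perm_inj _ s)).
apply: modular_prod => i; rewrite mxE; apply: Pseq_modular; rewrite -ltnS; exact: ltn_ord.
Qed.

(** [Pmx] sends the column of powers of E2 to the column of iterated Serre derivatives of the form.
    Multiplying by the adjugate, the entry of E2^0 = 1 expresses the determinant as a combination of
    these derivatives, all vanishing up to N. *)
Lemma det_vanish N : (forall n, (n <= N)%N -> qeval P0 n = 0) ->
  forall n, (n <= N)%N -> (\det Pmx) n = 0.
Proof.
move=> v0 n len.
pose c : 'cV[S]_k.+1 := \col_i e ^+ i.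
have := congr1 (fun A : 'cV[S]_k.+1 => A ord0 ord0) (mulmxA (\adj Pmx) Pmx c).
rewrite mul_adj_mx mul_scalar_mx !mxE expr0 mulr1 => <-.
rewrite fcoef_sum big1 // => j _; apply: fcoefM_eq0 (len) => i lei.
have -> : (Pmx *m c) j ord0 = qeval (Pseq j) by rewrite !mxE; apply: eq_bigr => l _; rewrite !mxE.
exact: Pseq_vanish v0 j i lei.
Qed.

(** Defined on all polynomials in log q, so that a linear relation between the [Pseq j] becomes a
    single differential operator killing [logpoly P0]. *)
Fixpoint serre_op j (F : {poly S}) : {poly S} := if j is i.+1
  then 12%:R *: dlog (serre_op i F) - ((2 * k + 2 * i - k)%:R * e) *: serre_op i F else F.

Lemma logpoly_Pseq j : logpoly (Pseq j) = serre_op j (logpoly P0).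
Proof.
elim: j => //= j <-; have := @dlog_logpoly (2 * k + 2 * j) (Pseq j) ltac:(lia) (@Pseq_supp j).
by move=> E; rewrite -!mul_polyC (polyC_natr _ 12) E addrK.
Qed.

Lemma serre_op_order j :
  order_lt j (fun F => serre_op j F - (12 ^+ j : S) *: iter j (@dlog K) F).
Proof.
elim: j => [|j IH].
  by exists (fun=> 0) => F; rewrite big_ord0 expr0 scale1r subrr.
pose L F := serre_op j F - (12 ^+ j : S) *: iter j (@dlog K) F.
have ltL : order_lt j.+1 (serre_op j).
  apply: (@order_lt_eq _ _ (fun F => L F + (12 ^+ j : S) *: iter j (@dlog K) F)).
    by move=> F; rewrite /L addrNK.
  by apply: order_ltD; [exact: order_ltW | exact: order_lt_iter].
have := order_ltD (order_ltZ 12 (order_lt_dlog IH))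
                  (order_ltZ (- ((2 * k + 2 * j - k)%:R * e)) ltL).
apply: order_lt_eq => F /=.
have -> : dlog (serre_op j F) = dlog (L F) + (12 ^+ j : S) *: iter j.+1 (@dlog K) F.
  rewrite -[serre_op j F](subrK ((12 ^+ j : S) *: iter j (@dlog K) F)) dlogD.
  by rewrite dlogZ -natrX theta_nat scale0r add0r natrX.
by rewrite -/(L F) exprS -!mul_polyC !polyCM !polyCN /=; ring.
Qed.

Lemma serre_op_lt j : order_lt j.+1 (serre_op j).
Proof.
have := order_ltD (order_ltW (serre_op_order j)) (order_lt_iter j (12 ^+ j : S)).
by apply: order_lt_eq => F; rewrite addrNK.
Qed.

(** A vector v in the left kernel yields an operator, the sum of v_j [serre_op j], of order at most
    k that kills [logpoly P0]. That polynomial has degree k in log q with the form as leading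
    coefficient, against [log_degree_lt_order]. *)
Lemma det_neq0 : qeval P0 != 0 -> \det Pmx != 0.
Proof.
move=> q0; apply/negP => /det0P[v v0 vM].
have [j0 vj0] : exists j, v ord0 j != 0.
  apply: contrapT => H; case/eqP: v0; apply/rowP => j; rewrite mxE.
  by apply: contrapT => /eqP vj; apply: H; exists j.
(* The last index r with v_r nonzero is the order of the operator, with leading coefficient v_r
   12^r. *)
case: (@arg_maxnP _ j0 (fun j => v ord0 j != 0) val vj0) => r vr rmax.
pose L F := \sum_(j < k.+1) v ord0 j *: serre_op j F.
have Lr : order_lt r (fun F => L F - (v ord0 r * 12 ^+ r) *: iter r (@dlog K) F).
  apply: (@order_lt_eq _ _ (fun F => \sum_(j < k.+1) v ord0 j *:
      (serre_op j F - (if j == r then 12 ^+ r else 0 : S) *: iter r (@dlog K) F))).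
    move=> F; rewrite /L (eq_bigr (fun j => v ord0 j *: serre_op j F
      - (if j == r then (v ord0 r * 12 ^+ r) *: iter r (@dlog K) F else 0))); last first.
      move=> j _; rewrite scalerBr scalerA; case: eqP => [->//|_].
      by rewrite mulr0 scale0r.
    by rewrite sumrB -big_mkcond big_pred1_eq.
  apply: order_lt_sum => j; have [-> |jr] := eqVneq j r.
    by apply: order_ltZ; exact: serre_op_order.
  have [ltjr|lerj] := ltnP j r.
    apply: order_ltZ; apply: (@order_lt_eq _ _ (serre_op j)).
      by move=> F; rewrite scale0r subr0.
    by apply: order_lt_le ltjr _; exact: serre_op_lt.
  have -> : v ord0 j = 0.
    apply: contraTeq lerj => /rmax lejr.
    by rewrite -ltnNge ltn_neqAle (inj_eq (@ord_inj _)) jr.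
  by exists (fun=> 0) => F; rewrite scale0r big1 // => i _; rewrite scale0r.
have L0 : L (logpoly P0) = 0.
  rewrite /L (eq_bigr (fun j : 'I_k.+1 => v ord0 j *: logpoly (Pseq j))); last first.
    by move=> j _; rewrite logpoly_Pseq.
  rewrite (eq_bigr (fun j : 'I_k.+1 => \sum_(i < k.+1)
    (v ord0 j * Pmx j i)%:P * slash ^+ i * 'X ^+ (k - i))); last first.
    move=> j _; rewrite scaler_sumr; apply: eq_bigr => i _.
    by rewrite mxE -mul_polyC polyCM !mulrA.
  rewrite exchange_big big1 //= => i _; rewrite -!mulr_suml -raddf_sum.
  have := congr1 (fun A : 'rV[S]_k.+1 => A ord0 i) vM; rewrite !mxE => E.
  by rewrite E raddf0 !mul0r.
have : L (logpoly P0) != 0.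
  have neq12 : (12 : S) != 0.
    by apply/eqP => /(congr1 (fun f : S => f 0%N))/eqP; rewrite fcoef_nat fcoef0 pnatr_eq0.
  apply: log_degree_lt_order Lr _ _; first by rewrite mulf_neq0 // expf_neq0.
  have lerk : (r <= k)%N by rewrite -ltnS.
  apply: leq_ltn_trans lerk _; rewrite ltnNge; apply: contraNN q0 => /leq_sizeP/(_ k (leqnn k)).
  by rewrite coef_logpoly => ->.
by rewrite L0 eqxx.
Qed.

Lemma qeval_vanish :
  (forall n, (n <= k.+1 * (2 * k) %/ 12)%N -> qeval P0 n = 0) -> qeval P0 = 0.
Proof.
move=> v0; apply/eqP; apply: contraT => /det_neq0/negP[].
by apply/eqP; apply: modular_vanish modular_det _; exact: det_vanish.
Qed.
End Quasimodular.

(** Grouping the monomials by their power of E2 gives coefficients P_a of weight 2k - 2a, to which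
    [qeval_vanish] applies. *)
Lemma quasimodular_vanish (K : numFieldType) (k : nat) (f : nat -> K) :
  quasimodular k f -> (forall n, (n <= k.+1 * (2 * k) %/ 12)%N -> f n = 0) ->
  forall n, f n = 0.
Proof.
move=> [coef fE] f0.
pose P (a : nat) : fps K := if (a <= k)%N then \sum_(b < k.+1) \sum_(c < k.+1)
  (if (2 * a + 4 * b + 6 * c == 2 * k)%N
   then fcst (coef a b c) * qE4 K ^+ b * qE6 K ^+ c else 0) else 0.
have qpowE (g : nat -> K) m : Fps (qpow g m) = Fps g ^+ m.
  by elim: m => // m IH; rewrite exprS -IH.
have evalE : qeval k P = Fps f.
  rewrite fE; apply: fps_ext => n; rewrite /qeval fcoef_sum; apply: eq_bigr => a _.
  rewrite /P -ltnS ltn_ord mulr_suml fcoef_sum; apply: eq_bigr => b _.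
  rewrite mulr_suml fcoef_sum; apply: eq_bigr => c _.
  case: ifP => _; last by rewrite mul0r.
  have -> : E246 K a b c n = (qE2 K ^+ a * (qE4 K ^+ b * qE6 K ^+ c)) n.
    by rewrite -!qpowE.
  by rewrite -fcoef_cstM; congr (fcoef _ n); ring.
have supp i : (k < i)%N -> P i = 0 by rewrite /P ltnNge => /negbTE ->.
have mod i : (i <= k)%N -> modular (2 * k - 2 * i) (P i).
  move=> lei; rewrite /P lei; apply: modular_sum => b _; apply: modular_sum => c _.
  case: eqP => [E|_]; last exact: modular0.
  by apply: (@modular_mon_eq _ (coef i b c) b c) => //; lia.
have q0 : qeval k P = 0 by apply: qeval_vanish => // n len; rewrite evalE; exact: f0.
by move=> n; have := congr1 (fun g : fps K => g n) evalE; rewrite q0 fcoef0.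
Qed.

(** * Comparison with the bound k^4 log(k) / 2 *)

Lemma half_le_ln (R : realType) (k : nat) : (2 <= k)%N -> 2^-1 <= ln (k%:R : R).
Proof.
move=> le2k; have k2 : (2 : R) <= k%:R by rewrite ler_nat.
have k0 : (0 : R) < k%:R by lra.
rewrite -[leLHS]expRK ler_ln ?posrE ?expR_gt0 //.
(* In reciprocal form the tangent bound suffices: exp(-1/2) >= 1 - 1/2 >= 1/k. *)
rewrite -[leLHS]invrK -expRN invf_ple ?posrE ?expR_gt0 //.
apply: le_trans (expR_ge1Dx _); have : (k%:R : R)^-1 <= 2^-1 by rewrite lef_pV2 ?posrE.
lra.
Qed.

(** For k >= 2, 2k(k + 1) <= 3k^2 <= 3k^4 bounds the left side by k^4 / 4, and log k >= 1/2 bounds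
    the right side below by the same value. For k < 2 the left side is 0. *)
Lemma le_sturm_bound (R : realType) (k : nat) :
  (k.+1 * (2 * k) %/ 12 <= sturm_bound R k)%N.
Proof.
have [le2k|] := leqP 2 k; last by case: k => [|[|k]] //.
set q := (_ %/ 12)%N.
have le4q : (4 * q <= k ^ 4)%N.
  have := leq_divM (k.+1 * (2 * k)) 12; rewrite -/q => le12q.
  have : (k ^ 2 <= k ^ 4)%N by rewrite leq_exp2l.
  nia.
suff : (q%:Z <= Num.ceil ((k%:R : R) ^+ 4 * ln (k%:R : R) / 2))%R by rewrite /sturm_bound; lia.
rewrite -(ler_int R); apply: le_trans (ceil_ge _).
have {le4q} : (4 * q%:R : R) <= k%:R ^+ 4 by rewrite -natrX -natrM ler_nat.
have := half_le_ln R le2k; have : (0 : R) <= k%:R ^+ 4 by rewrite exprn_ge0.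
move: (ln _) (_ ^+ 4) => l x x0 l2 leq; rewrite -[q%:~R]/(q%:R).
nra.
Qed.

Theorem theorem1p4 (R : realType) (k : nat) (f : nat -> R[i]) :
  (1 <= k)%N ->
  quasimodular k f ->
  (forall n : nat, (n <= sturm_bound R k)%N -> f n = 0) ->
  forall n : nat, f n = 0.
Proof.
move=> _ fq f0; apply: quasimodular_vanish fq _ => n len.
by apply: f0; apply: leq_trans len (le_sturm_bound R k).
Qed.
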